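(* Every $n$-qubit unitary stabilizer circuit has an equivalent circuit in canonical form, i.e. one consisting of $11$ consecutive rounds in the sequence H-C-P-C-P-C-H-P-C-P-C, where a round of type H contains only Hadamard gates, a round of type C contains only CNOT gates, and a round of type P contains only phase gates (rounds may be empty).
   Context: A unitary stabilizer circuit is a circuit consisting only of CNOT gates, Hadamard gates $H=\frac{1}{\sqrt2}\begin{pmatrix}1&1\\1&-1\end{pmatrix}$ and phase gates $\mathrm{diag}(1,i)$. Two unitary stabilizer circuits are equivalent if the unitaries they implement are equal up to a global phase (equivalently, they map each stabilizer state to the same physical state). *)

(* Defs.v *)
From HB Require Import structures.
From mathcomp Require Import all_boot all_order all_algebra all_field.
Set Implicit Arguments. Unset Strict Implicit. Unset Printing Implicit Defensive.
Import Order.TTheory GRing.Theory Num.Theory.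
Local Open Scope ring_scope.

(* Computational basis of n qubits: index k : 'I_(2^n); qubit q of basis
   state k is bit q of k. *)
Definition qbit (k q : nat) : bool := odd (k %/ 2 ^ q)%N.

Inductive gate (n : nat) : Type :=
| Had  of 'I_n
| Phs  of 'I_n
| CNOT of 'I_n & 'I_n.        (* CNOT (control, target) *)

Definition valid_gate n (g : gate n) : bool :=
  match g with CNOT a b => a != b | _ => true end.

Definition flipbit (k b : nat) : nat :=
  (if qbit k b then k - 2 ^ b else k + 2 ^ b)%N.

(* Hadamard H = 1/sqrt2 [[1,1],[1,-1]] on qubit q *)
Definition had_mx n (q : 'I_n) : 'M[algC]_(2 ^ n) :=
  \matrix_(r, c)
    if [forall j : 'I_n, (j != q) ==> (qbit r j == qbit c j)]
    then (if qbit r q && qbit c q then -1 else 1) / sqrtC 2%:R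
    else 0.

Definition phs_mx n (q : 'I_n) : 'M[algC]_(2 ^ n) :=
  \matrix_(r, c) if r == c then (if qbit c q then 'i else 1) else 0.

Definition cnot_mx n (a b : 'I_n) : 'M[algC]_(2 ^ n) :=
  \matrix_(r, c)
    (if (r : nat) == (if qbit c a then flipbit c b else (c : nat)) then 1 else 0).

Definition gate_mx n (g : gate n) : 'M[algC]_(2 ^ n) :=
  match g with
  | Had q => had_mx q
  | Phs q => phs_mx q
  | CNOT a b => cnot_mx a b
  end.

(* A circuit is a sequence of gates, applied left to right (first gate first);
   it acts on column vectors, so its unitary is U_k * ... * U_1. *)
Definition circuit n := seq (gate n).

Definition circuit_mx n (c : circuit n) : 'M[algC]_(2 ^ n) :=
  foldl (fun U g => gate_mx g *m U) 1%:M c.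

Definition valid_circuit n (c : circuit n) : bool := all (@valid_gate n) c.

Definition equiv_circuits n (c1 c2 : circuit n) : Prop :=
  exists z : algC, `|z| = 1 /\ circuit_mx c1 = z *: circuit_mx c2.

Definition is_H n (g : gate n) : bool := if g is Had _ then true else false.
Definition is_P n (g : gate n) : bool := if g is Phs _ then true else false.
Definition is_C n (g : gate n) : bool := if g is CNOT _ _ then true else false.

Definition canonical_form n (c : circuit n) : Prop :=
  exists r1 r2 r3 r4 r5 r6 r7 r8 r9 r10 r11 : circuit n,
    [/\ c = r1 ++ r2 ++ r3 ++ r4 ++ r5 ++ r6 ++ r7 ++ r8 ++ r9 ++ r10 ++ r11,
        [&& all (@is_H n) r1, all (@is_C n) r2, all (@is_P n) r3,
            all (@is_C n) r4, all (@is_P n) r5 & all (@is_C n) r6]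
      &        [&& all (@is_H n) r7, all (@is_P n) r8, all (@is_C n) r9,
            all (@is_P n) r10 & all (@is_C n) r11] ].

(* Main.v *)
(* The matrix of a circuit is viewed as a kernel on pairs of bit vectors.  Call
   a function [f] on an elementary abelian 2-group quadratic if it vanishes nowhere
   and [f (z + u) / f z] is, for each [u], of the form [i ^ a * (-1) ^ m z] with
   [m] affine.  After prepending suitable Hadamard gates, the kernel of every
   circuit is quadratic: phase and CNOT gates multiply by a phase and substitute
   linearly, while a further Hadamard gate sums over one bit, which gives either
   a quadratic kernel again or one supported on an affine hyperplane; in the
   latter case one more prepended Hadamard gate restores full support.
   A quadratic kernel of an invertible matrix factors as
   [q1 y * (-1) ^ (y . g x) * q2 x] with [g] in GL_n(F_2), that is as a Hadamard
   layer between two maps [|x> -> q x |h x>].  Completing squares, that is, a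
   Cholesky decomposition over F_2, turns each of these maps into P-C-P-C.  The
   prepended Hadamard gates are undone by the first round. *)
Require Import Defs.
From HB Require Import structures.
From mathcomp Require Import all_boot all_order all_algebra all_field.
From mathcomp Require Import ring.
Set Implicit Arguments. Unset Strict Implicit. Unset Printing Implicit Defensive.
Import Order.TTheory GRing.Theory Num.Theory.
Local Open Scope ring_scope.

(** * Basis states as bit vectors *)

Notation bitvec n := {ffun 'I_n -> bool}.

Definition bits n (k : 'I_(2 ^ n)) : bitvec n := [ffun q : 'I_n => qbit k q].

Lemma qbit0 k : qbit k 0 = odd k.
Proof. by rewrite /qbit expn0 divn1. Qed.

Lemma qbitS k q : qbit k q.+1 = qbit k./2 q.
Proof. by rewrite /qbit expnS divnMA divn2. Qed.

Lemma qbit_ext n k l : (k < 2 ^ n)%N -> (l < 2 ^ n)%N ->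
  (forall q, (q < n)%N -> qbit k q = qbit l q) -> k = l.
Proof.
elim: n k l => [|n IHn] k l; first by rewrite expn0; case: k l => [|?] [|?].
rewrite expnS mul2n -!ltn_half_double => ltk ltl eq_kl.
rewrite -(odd_double_half k) -(odd_double_half l) -!qbit0 (eq_kl 0%N) //.
by congr (_ + _.*2)%N; apply: IHn => // q ltqn; rewrite -!qbitS eq_kl.
Qed.

Lemma bits_inj n : injective (@bits n).
Proof.
move=> k l eq_kl; apply/val_inj/(@qbit_ext n) => [||q ltqn]; rewrite ?ltn_ord //.
by have /ffunP/(_ (Ordinal ltqn)) := eq_kl; rewrite !ffunE.
Qed.

Lemma bits_bij n : bijective (@bits n).
Proof.
by apply: inj_card_bij (@bits_inj n) _; rewrite card_ffun card_bool !card_ord.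
Qed.

Lemma flipbitS k b : flipbit k b.+1 = (odd k + (flipbit k./2 b).*2)%N.
Proof.
rewrite /flipbit qbitS; case: ifPn => [kb|_].
  (* A set bit [b] of [k./2] bounds it below by [2 ^ b], so the natural-number subtraction is not
     truncated. *)
  have le_bk : (2 ^ b <= k./2)%N.
    by rewrite leqNgt; apply: contraL kb => lt_kb; rewrite /qbit divn_small.
  rewrite doubleB addnBA ?leq_double // odd_double_half -mul2n -expnS //.
by rewrite doubleD addnA odd_double_half -mul2n -expnS.
Qed.

Lemma flipbit_lt n k b : (b < n)%N -> (k < 2 ^ n)%N -> (flipbit k b < 2 ^ n)%N.
Proof.
elim: n k b => // n IHn k [|b] ltbn; rewrite expnS mul2n => ltk.
  rewrite /flipbit qbit0 expn0; case: ifPn => [_|k_even].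
    exact: leq_ltn_trans (leq_subr _ _) ltk.
  by rewrite -[k]odd_double_half (negbTE k_even) addn1 -!doubleS leq_double
     -ltn_half_double in ltk *; rewrite ?doubleK in ltk *.
rewrite flipbitS -ltn_half_double halfD odd_double andbF add0n doubleK.
by case: (odd k) => /=; apply: IHn; rewrite // ltn_half_double.
Qed.

Lemma qbit_flipbit k b q : qbit (flipbit k b) q = qbit k q (+) (q == b).
Proof.
elim: b k q => [|b IHb] k q.
  rewrite /flipbit qbit0 expn0.
  have -> : (if odd k then k - 1 else k + 1)%N = (~~ odd k + k./2.*2)%N.
    rewrite -{2 3}[k]odd_double_half.
    by case: (odd k); rewrite ?addnK ?add0n ?addn1 ?add1n ?subn1.
  case: q => [|q]; first by rewrite !qbit0 oddD odd_double addbF oddb addbT.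
  by rewrite !qbitS half_bit_double addbF.
rewrite flipbitS; case: q => [|q].
  by rewrite !qbit0 oddD odd_double !addbF oddb.
by rewrite !qbitS half_bit_double IHb.
Qed.

(** * Changing a single bit *)

Definition upd n (x : bitvec n) q b : bitvec n :=
  [ffun j => if j == q then b else x j].

Lemma upd_eq n (x : bitvec n) q b : upd x q b q = b.
Proof. by rewrite ffunE eqxx. Qed.

Lemma upd_neq n (x : bitvec n) q b j : j != q -> upd x q b j = x j.
Proof. by rewrite ffunE => /negbTE->. Qed.

Lemma upd_id n (x : bitvec n) q : upd x q (x q) = x.
Proof. by apply/ffunP => j; rewrite ffunE; case: eqP => // ->. Qed.

Lemma upd_upd n (x : bitvec n) q b b' : upd (upd x q b) q b' = upd x q b'.
Proof. by apply/ffunP => j; rewrite !ffunE; case: eqP. Qed.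

Lemma updD n (x y : bitvec n) q b b' :
  upd (x + y) q (b + b') = upd x q b + upd y q b'.
Proof. by apply/ffunP => j; rewrite !ffunE; case: eqP. Qed.

Definition bvec n (q : 'I_n) : bitvec n := upd 0 q true.

Lemma updE n (x : bitvec n) q b :
  upd x q b = upd x q false + (if b then bvec q else 0).
Proof.
case: b; last by rewrite addr0.
by rewrite /bvec -updD addr0.
Qed.

(** Exactly two vectors agree with [x] away from [q], one for each value of bit [q]. *)
Lemma sum_upd n (x : bitvec n) q (F : bitvec n -> algC) :
  \sum_z (if upd x q false == upd z q false then F z else 0)
    = F (upd x q false) + F (upd x q true).
Proof.
rewrite -big_mkcond (bigD1 (upd x q false)) ?upd_upd //=.
rewrite (bigD1 (upd x q true)) /=; last first.
  rewrite upd_upd eqxx; apply/eqP => /ffunP/(_ q).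
  by rewrite !upd_eq.
rewrite big1 ?addr0 // => z /andP[/andP[/eqP xz zN0] zN1].
have updz b : upd x q b = upd z q b.
  by rewrite -(upd_upd x q false) xz upd_upd.
by move: zN0 zN1; rewrite !updz; case: (z q) (upd_id z q) => ->; rewrite eqxx.
Qed.

(** * Kernels of gates and circuits *)

Definition has_ker n (U : 'M[algC]_(2 ^ n)) (K : bitvec n -> bitvec n -> algC) :=
  forall r c, U r c = K (bits r) (bits c).

Lemma has_ker_eq n (U V : 'M[algC]_(2 ^ n)) K : has_ker U K -> has_ker V K -> U = V.
Proof. by move=> rU rV; apply/matrixP => r c; rewrite rU rV. Qed.

Lemma has_ker_ext n (U : 'M[algC]_(2 ^ n)) K L :
  has_ker U K -> (forall y x, K y x = L y x) -> has_ker U L.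
Proof. by move=> rU eqKL r c; rewrite rU eqKL. Qed.

Lemma has_ker_mulmx n (U V : 'M[algC]_(2 ^ n)) K L : has_ker U K -> has_ker V L ->
  has_ker (U *m V) (fun y x => \sum_z K y z * L z x).
Proof.
move=> rU rV r c; rewrite mxE (reindex (@bits n)); last exact/onW_bij/bits_bij.
by apply: eq_bigr => k _; rewrite rU rV.
Qed.

Lemma has_ker1 n : has_ker (1%:M : 'M[algC]_(2 ^ n)) (fun y x => (y == x)%:R).
Proof. by move=> r c; rewrite mxE (inj_eq (@bits_inj n)). Qed.

Lemma has_ker_tr n (U : 'M[algC]_(2 ^ n)) K :
  has_ker U K -> has_ker U^T (fun y x => K x y).
Proof. by move=> rU r c; rewrite mxE rU. Qed.

(** Agreement away from [q] is tested by clearing bit [q] on both sides, the guard that [sum_upd]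
    evaluates. *)
Definition had_ker n q (y x : bitvec n) : algC :=
  if upd y q false == upd x q false
  then (-1) ^+ (y q && x q) / sqrtC 2%:R else 0.

Lemma had_kerC n q (y x : bitvec n) : had_ker q y x = had_ker q x y.
Proof. by rewrite /had_ker eq_sym andbC. Qed.

Lemma sum_had_ker n q (y : bitvec n) (F : bitvec n -> algC) :
  \sum_z had_ker q y z * F z
    = (F (upd y q false) + (-1) ^+ (y q) * F (upd y q true)) / sqrtC 2%:R.
Proof.
under eq_bigr do rewrite /had_ker (fun_if ( *%R^~ _)) mul0r.
rewrite (sum_upd y q (fun z => (-1) ^+ (y q && z q) / sqrtC 2%:R * F z)).
by rewrite !upd_eq andbF andbT expr0 mul1r mulrDl mulrC [X in _ + X]mulrAC.
Qed.

Lemma has_ker_had n (q : 'I_n) : has_ker (had_mx q) (had_ker q).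
Proof.
move=> r c; rewrite mxE /had_ker; congr (if _ then _ else _).
  apply/forallP/eqP => [eq_rc|eq_rc j].
    apply/ffunP => j; rewrite !ffunE; case: eqVneq => // jq.
    by apply/eqP; apply: (implyP (eq_rc j)).
  apply/implyP => jq; have /ffunP/(_ j) := eq_rc.
  by rewrite !upd_neq // !ffunE => ->.
by congr (_ / _); rewrite !ffunE; case: ifP.
Qed.

Lemma has_ker_had_mul n (q : 'I_n) U K : has_ker U K ->
  has_ker (had_mx q *m U) (fun y x =>
    (K (upd y q false) x + (-1) ^+ (y q) * K (upd y q true) x) / sqrtC 2%:R).
Proof.
move=> rU; apply: has_ker_ext (has_ker_mulmx (has_ker_had q) rU) _ => y x.
exact: sum_had_ker (K^~ x).
Qed.

Lemma has_ker_mul_had n (q : 'I_n) U K : has_ker U K ->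
  has_ker (U *m had_mx q) (fun y x =>
    (K y (upd x q false) + (-1) ^+ (x q) * K y (upd x q true)) / sqrtC 2%:R).
Proof.
move=> rU; apply: has_ker_ext (has_ker_mulmx rU (has_ker_had q)) _ => y x.
rewrite -sum_had_ker; apply: eq_bigr => z _.
by rewrite mulrC had_kerC.
Qed.

(* The map |x> -> phi(x) |g x>. *)
Definition monomial n (U : 'M[algC]_(2 ^ n)) phi (g : bitvec n -> bitvec n) :=
  has_ker U (fun y x => if y == g x then phi x else 0).

Lemma monomial_mul n (U V : 'M[algC]_(2 ^ n)) phi g psi h :
  monomial U phi g -> monomial V psi h ->
  monomial (U *m V) (fun x => phi (h x) * psi x) (g \o h).
Proof.
move=> mU mV; apply: has_ker_ext (has_ker_mulmx mU mV) _ => y x /=.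
rewrite (bigD1 (h x)) //= eqxx big1 ?addr0 => [|z /negbTE->]; last exact: mulr0.
by case: eqP; rewrite ?mul0r.
Qed.

Lemma has_ker_mul_monomial n (U V : 'M[algC]_(2 ^ n)) K phi g :
  has_ker U K -> monomial V phi g ->
  has_ker (U *m V) (fun y x => K y (g x) * phi x).
Proof.
move=> rU mV; apply: has_ker_ext (has_ker_mulmx rU mV) _ => y x /=.
rewrite (bigD1 (g x)) //= eqxx big1 ?addr0 // => z /negbTE->; exact: mulr0.
Qed.

Lemma has_ker_monomial_mul n (U V : 'M[algC]_(2 ^ n)) K phi g g' :
  cancel g g' -> cancel g' g -> monomial U phi g -> has_ker V K ->
  has_ker (U *m V) (fun y x => phi (g' y) * K (g' y) x).
Proof.
move=> gK g'K mU rV; apply: has_ker_ext (has_ker_mulmx mU rV) _ => y x /=.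
rewrite (bigD1 (g' y)) //= g'K eqxx big1 ?addr0 // => z.
by rewrite -(can_eq g'K) gK eq_sym => /negbTE->; rewrite mul0r.
Qed.

Lemma monomial_phs n (q : 'I_n) : monomial (phs_mx q) (fun x => 'i ^+ x q) id.
Proof.
move=> r c; rewrite mxE (inj_eq (@bits_inj n)) ffunE.
by case: ifP => //; case: qbit.
Qed.

(* [x |-> x + x_p w]; for [w = bvec b] this is CNOT with control p and target b. *)
Definition transv n p (w x : bitvec n) : bitvec n := if x p then x + w else x.

Lemma bitvecDD n (x : bitvec n) : x + x = 0.
Proof. by apply/ffunP => q; rewrite !ffunE; exact: addbb. Qed.

Lemma transvK n p (w : bitvec n) : w p = false -> involutive (transv p w).
Proof.
move=> wp x; rewrite /transv; case xp: (x p); last by rewrite xp.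
by rewrite ffunE wp addr0 xp -addrA bitvecDD addr0.
Qed.

Lemma monomial_cnot n (a b : 'I_n) :
  monomial (cnot_mx a b) (fun=> 1) (transv a (bvec b)).
Proof.
move=> r c; rewrite mxE; congr (if _ then _ else _).
have -> : bits r == transv a (bvec b) (bits c)
   = (bits r == [ffun q : 'I_n => qbit (if qbit c a then flipbit c b else c) q]).
  congr (_ == _); apply/ffunP => q; rewrite /transv !ffunE.
  case: ifP => _; rewrite !ffunE // qbit_flipbit; congr (_ (+) _).
  by rewrite -val_eqE; case: eqP.
apply/eqP/eqP => eq_rc; first by apply/ffunP => q; rewrite !ffunE eq_rc.
apply: (@qbit_ext n) => [||q ltqn]; rewrite ?ltn_ord //.
  by case: ifP => _; rewrite ?flipbit_lt.
by have /ffunP/(_ (Ordinal ltqn)) := eq_rc; rewrite !ffunE.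
Qed.

(** * Invertibility and determinants of circuits *)

Lemma had_mxK n (q : 'I_n) : had_mx q *m had_mx q = 1%:M.
Proof.
apply: has_ker_eq (@has_ker1 n).
apply: has_ker_ext (has_ker_had_mul q (has_ker_had q)) _ => y x.
rewrite /had_ker !upd_upd !upd_eq /=.
have sqrt2 : (sqrtC 2%:R)^-1 * (sqrtC 2%:R)^-1 = 2%:R^-1 :> algC.
  by rewrite -invfM -expr2 sqrtCK.
case: eqVneq => [eq_yx|ne_yx]; last first.
  have -> : (y == x) = false by apply: contraNF ne_yx => /eqP->.
  by rewrite mulr0 addr0 mul0r.
have -> : (y == x) = (y q == x q).
  apply/eqP/eqP => [->//|eq_q]; rewrite -(upd_id y q) -(upd_id x q) eq_q.
  by rewrite -(upd_upd y q false) eq_yx upd_upd.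
rewrite mulrA -mulrDl -mulrA sqrt2.
have two : (1 + 1) / 2%:R = 1 :> algC by rewrite -[1 + 1]/2%:R divff ?pnatr_eq0.
case: (y q) (x q) => [] [] /=.
all: rewrite ?expr0 ?expr1 ?mulrNN ?mul1r ?mulr1 ?subrr ?mul0r ?mulr0n.
all: by [|exact: two].
Qed.

Lemma cnot_mxK n (a b : 'I_n) : a != b -> cnot_mx a b *m cnot_mx a b = 1%:M.
Proof.
move=> ne_ab; apply: has_ker_eq (@has_ker1 n).
have /monomial_mul mC := monomial_cnot a b.
apply: has_ker_ext (mC _ _ _ (monomial_cnot a b)) _ => y x /=.
by rewrite transvK ?upd_neq ?ffunE // mulr1; case: eqP.
Qed.

(** This stands in for unitarity: it yields both the invertibility of circuits and the modulus of a
    scalar relating two circuits. Hadamard and CNOT are involutions; the phase gate is diagonal with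
    entries of modulus one. *)
Lemma normr_det_gate n (g : gate n) : valid_gate g -> `|\det (gate_mx g)| = 1.
Proof.
have inv_det (U : 'M[algC]_(2 ^ n)) : U *m U = 1%:M -> `|\det U| = 1.
  move/(congr1 (fun V => `|\det V|)); rewrite det_mulmx det1 normrM normr1 -expr2.
  by move/eqP; rewrite pexpr_eq1 // => /eqP.
case: g => [q|q|a b] /=; [|move=> _|].
- by move=> _; apply/inv_det/had_mxK.
- rewrite det_trig; last first.
    apply/is_trig_mxP => r c lt_rc; rewrite mxE -val_eqE ifN //.
    by rewrite neq_ltn lt_rc.
  rewrite normr_prod big1 // => r _; rewrite mxE eqxx.
  by case: ifP; rewrite ?normCi ?normr1.
- by move=> ne_ab; apply/inv_det/cnot_mxK.
Qed.

Lemma circuit_mx_cat n (c1 c2 : circuit n) :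
  circuit_mx (c1 ++ c2) = circuit_mx c2 *m circuit_mx c1.
Proof.
rewrite /circuit_mx foldl_cat; move: (foldl _ _ c1) => U.
elim/last_ind: c2 => [|c2 g IHc]; first by rewrite mul1mx.
by rewrite -!cats1 !foldl_cat /= IHc mulmxA.
Qed.

Lemma circuit_mx_rcons n (c : circuit n) g :
  circuit_mx (rcons c g) = gate_mx g *m circuit_mx c.
Proof. by rewrite -cats1 circuit_mx_cat /circuit_mx /= mulmx1. Qed.

Lemma circuit_mx_cons n (c : circuit n) g :
  circuit_mx (g :: c) = circuit_mx c *m gate_mx g.
Proof. by rewrite -cat1s circuit_mx_cat /circuit_mx /= mulmx1. Qed.

Lemma normr_det_circuit n (c : circuit n) :
  valid_circuit c -> `|\det (circuit_mx c)| = 1.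
Proof.
elim: c => [_|g c IHc /andP[vg vc]]; first by rewrite det1 normr1.
by rewrite circuit_mx_cons det_mulmx normrM IHc // normr_det_gate // mulr1.
Qed.

Lemma circuit_unitmx n (c : circuit n) :
  valid_circuit c -> circuit_mx c \in unitmx.
Proof.
by move/normr_det_circuit=> d1; rewrite unitmxE unitfE -normr_eq0 d1 oner_eq0.
Qed.

(** Comparing determinants gives [|z| ^+ (2 ^ n) = 1], so any proportionality factor is
    automatically a global phase. *)
Lemma equiv_circuits_scale n (c1 c2 : circuit n) z :
  valid_circuit c1 -> valid_circuit c2 ->
  circuit_mx c1 = z *: circuit_mx c2 -> equiv_circuits c1 c2.
Proof.
move=> v1 v2 eq12; exists z; split=> //.
have := congr1 (fun V => `|\det V|) eq12.
rewrite /= detZ normrM !normr_det_circuit // mulr1 normrX => /esym/eqP.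
by rewrite pexpr_eq1 ?expn_gt0 // => /eqP.
Qed.

(** The form in which invertibility is used later. The basis row at [y] minus [z] times the one at
    [y'] is killed by [U], hence is zero, which is absurd at coordinate [y] unless [y = y']. *)
Lemma has_ker_row_indep n (U : 'M[algC]_(2 ^ n)) K y y' (z : algC) :
  U \in unitmx -> has_ker U K -> (forall x, K y x = z * K y' x) -> y = y'.
Proof.
move=> uU rU Kyy'; have [ind indK bitsK] := bits_bij n.
apply/eqP; apply/negPn/negP => ne_yy'.
have : (delta_mx 0 (ind y) - z *: delta_mx 0 (ind y') : 'rV_(2 ^ n)) *m U = 0.
  rewrite mulmxBl -scalemxAl -!rowE; apply/matrixP => i c.
  by rewrite !mxE !rU !bitsK Kyy' subrr.
move/(congr1 (mulmx^~ (invmx U))); rewrite mulmxK // mul0mx.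
move/matrixP/(_ 0 (ind y)); rewrite !mxE !eqxx (can_eq bitsK) (negbTE ne_yy').
by rewrite mulr0 subr0 => /eqP; rewrite oner_eq0.
Qed.

Lemma has_ker_col_indep n (U : 'M[algC]_(2 ^ n)) K x x' (z : algC) :
  U \in unitmx -> has_ker U K -> (forall y, K y x = z * K y x') -> x = x'.
Proof. by rewrite -unitmx_tr => uU /has_ker_tr; exact: has_ker_row_indep. Qed.

(** * Quadratic phase functions *)

Definition additive_fun (aT rT : zmodType) (g : aT -> rT) :=
  forall u v, g (u + v) = g u + g v.

(* In characteristic 2 this says that [g] is additive up to a constant. *)
Definition affine_fun (aT rT : zmodType) (g : aT -> rT) :=
  forall u v w, g (u + v + w) = g u + g v + g w.

(** On an elementary abelian 2-group these are the nonzero constant multiples of [i ^ q], with [q] a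
    quadratic form valued in Z/4. The condition on first differences makes closure under products
    and affine substitutions easy. *)
Definition quad (T : zmodType) (f : T -> algC) :=
  (forall z, f z != 0) /\
  forall u, exists a, exists2 m : T -> bool, affine_fun m &
    forall z, f (z + u) = f z * 'i ^+ a * (-1) ^+ m z.

(** The sign is the carry: [b + c] exceeds [b (+) c] by 2 exactly when both bits are set. *)
Lemma expr_addb b c : 'i ^+ (b (+) c) = 'i ^+ b * 'i ^+ c * (-1) ^+ (b && c) :> algC.
Proof.
case: b c => [] []; rewrite /= ?expr0 ?expr1 ?mulr1 ?mul1r //.
by rewrite -expr2 sqrCi mulrNN mulr1.
Qed.

Lemma bool_addE (b c : bool) : b + c = b (+) c. Proof. by []. Qed.

Section Quad.
Variable T : zmodType.
Implicit Types (f g : T -> algC) (l m : T -> bool).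

Lemma affine_add l m : affine_fun l -> affine_fun m ->
  affine_fun (fun z => l z + m z).
Proof.
by move=> al am u v w; rewrite al am addrACA [l u + l v + _]addrACA.
Qed.

Lemma affine_and l b : affine_fun l -> affine_fun (fun z => l z && b).
Proof. by move=> al u v w; rewrite al !bool_addE -!andb_addl. Qed.

Lemma affine_cst (rT : zmodType) (b : rT) : b + b = 0 -> affine_fun (fun _ : T => b).
Proof. by move=> bb u v w; rewrite bb add0r. Qed.

Lemma additive_affine (rT : zmodType) (g : T -> rT) : additive_fun g -> affine_fun g.
Proof. by move=> ag u v w; rewrite !ag. Qed.

Lemma affine_comp (T1 T2 : zmodType) (g : T -> T1) (h : T1 -> T2) :
  affine_fun g -> affine_fun h -> affine_fun (h \o g).
Proof. by move=> ag ah u v w /=; rewrite ag ah. Qed.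

Lemma quad_ext f g : f =1 g -> quad f -> quad g.
Proof.
move=> eq_fg [f0 qf]; split=> [z|u]; first by rewrite -eq_fg.
by have [a [m am fE]] := qf u; exists a, m => // z; rewrite -!eq_fg.
Qed.

Lemma quad_cst (c : algC) : c != 0 -> quad (fun _ : T => c).
Proof.
move=> c0; split=> // u; exists 0%N, (fun=> false); first exact: affine_cst.
by move=> z; rewrite !mulr1.
Qed.

Lemma quad_mul f g : quad f -> quad g -> quad (fun z => f z * g z).
Proof.
move=> [f0 qf] [g0 qg]; split=> [z|u]; first by rewrite mulf_neq0.
have [a [l al fE]] := qf u; have [b [m am gE]] := qg u.
exists (a + b)%N, (fun z => l z + m z); first exact: affine_add.
move=> z; rewrite fE gE exprD signr_addb.
by rewrite mulrACA [f z * _ * _]mulrACA.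
Qed.

Lemma quad_exp f k : quad f -> quad (fun z => f z ^+ k).
Proof.
move=> qf; elim: k => [|k IHk]; first exact/quad_cst/oner_neq0.
by apply: quad_ext (quad_mul qf IHk) => z; rewrite exprS.
Qed.

(** Affinity at [z], [u], [0] turns translation by [u] into translation by [g u + g 0], so a first
    difference of [f \o g] is one of [f]. *)
Lemma quad_comp (T' : zmodType) (f : T' -> algC) (g : T -> T') :
  affine_fun g -> quad f -> quad (f \o g).
Proof.
move=> ag [f0 qf]; split=> [z|u] /=; first exact: f0.
have [a [m am fE]] := qf (g u + g 0).
exists a, (m \o g) => [|z]; first exact: affine_comp.
by rewrite -[z + u]addr0 ag -addrA fE.
Qed.

Lemma quad_i l : affine_fun l -> quad (fun z => 'i ^+ l z).
Proof.
move=> al; split=> [z|u]; first by rewrite expf_neq0 ?neq0Ci.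
exists (l u + l 0 : bool), (fun z => l z && (l u + l 0)); first exact: affine_and.
by move=> z; rewrite -[z + u]addr0 al -addrA expr_addb.
Qed.

Lemma quad_sign_and l m :
  affine_fun l -> affine_fun m -> quad (fun z => (-1) ^+ (l z && m z)).
Proof.
move=> al am; split=> [z|u]; first by rewrite signr_eq0.
(* Translation by [u] changes [l] by [c] and [m] by [d]. Expanding the product [(l + c) (m + d)]
   leaves the affine cross terms and the constant [c d], whose sign is ['i ^+ (2 * (c && d))]. *)
set c := l u + l 0; set d := m u + m 0.
exists (2 * (c && d))%N, (fun z => (l z && d) + (m z && c)).
  by apply: affine_add; exact: affine_and.
move=> z; rewrite exprM sqrCi -!signr_addb; congr (_ ^+ nat_of_bool _).
rewrite -[z + u]addr0 al am -!addrA -/c -/d !bool_addE.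
by case: (l z) (m z) c d => [] [] [] [].
Qed.

(** The constant term [m 0] of the affine exponent moves into the power of ['i], where it counts
    twice. *)
Lemma quad_additive f u : quad f ->
  exists a, exists2 m : T -> bool, additive_fun m &
    forall z, f (z + u) = f z * 'i ^+ a * (-1) ^+ m z.
Proof.
case=> _ /(_ u)[a [m am fE]]; exists (a + 2 * m 0%R)%N, (fun z => m z + m 0).
  move=> x y; rewrite -[x + y]addr0 am !bool_addE.
  by case: (m x) (m y) (m 0) => [] [] [].
move=> z; rewrite fE exprD exprM sqrCi -!mulrA; congr (_ * (_ * _)).
by rewrite -signr_addb bool_addE addbA addbC addbA addbb.
Qed.

End Quad.

Lemma additive0 (aT rT : zmodType) (g : aT -> rT) : additive_fun g -> g 0 = 0.
Proof. by move=> ag; apply: (addrI (g 0)); rewrite -ag !addr0. Qed.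

Lemma additive_inj (aT rT : zmodType) (g : aT -> rT) : additive_fun g ->
  (forall x, g x = 0 -> x = 0) -> injective g.
Proof.
move=> ag kerg x y eq_g; apply/eqP; rewrite -subr_eq0; apply/eqP/kerg.
by apply: (addIr (g y)); rewrite -ag subrK add0r.
Qed.

Lemma additive_sum (aT rT : zmodType) (g : aT -> rT) (I : Type) (r : seq I) P
    (F : I -> aT) :
  additive_fun g -> g (\sum_(i <- r | P i) F i) = \sum_(i <- r | P i) g (F i).
Proof. by move=> ag; rewrite (big_morph g ag (additive0 ag)). Qed.

(** * Completing squares bit by bit *)

Lemma bitvec_sum n (x : bitvec n) : x = \sum_(q | x q) bvec q.
Proof.
apply/ffunP => q; rewrite sum_ffunE; case xq: (x q).
  rewrite (bigD1 q) //= upd_eq big1 // => j /andP[_ jq].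
  by rewrite upd_neq ?ffunE // eq_sym.
by rewrite big1 // => j xj; rewrite upd_neq ?ffunE //; apply: contraFneq xq => ->.
Qed.

Definition tail n k (x : bitvec n) : bitvec n := [ffun q : 'I_n => (k <= q)%N && x q].

Lemma tailD n k : additive_fun (@tail n k).
Proof. by move=> x y; apply/ffunP => q; rewrite !ffunE; case: leqP. Qed.

Lemma tailS n (q : 'I_n) x :
  tail q x = tail q.+1 x + (if x q then bvec q else 0).
Proof.
apply/ffunP => j; rewrite !ffunE.
case: (ltngtP q j) => [ltqj|gtqj|/val_inj <-].
- by case: ifP; rewrite ?upd_neq ?ffunE ?addr0 // -val_eqE gtn_eqF.
- by case: ifP; rewrite ?upd_neq ?ffunE ?addr0 // -val_eqE ltn_eqF.
- by rewrite add0r; case: ifP; rewrite ?upd_eq ?ffunE.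
Qed.

(** Squares are completed from bit [k] upwards, [d] being the number of bits left. Each [m q] sees
    only bits strictly above [q]; this makes the change of variables in [quad_split]
    unitriangular. *)
Lemma quad_tail n k d (f : bitvec n -> algC) :
  (k + d)%N = n -> quad f -> f 0 = 1 ->
  exists (a : 'I_n -> nat) (m : 'I_n -> bitvec n -> bool),
    (forall q, additive_fun (m q)) /\
    forall x, f (tail k x) = \prod_(q < n | (k <= q)%N)
      ('i ^+ (a q * x q) * 'i ^+ (3 * (x q (+) m q (tail q.+1 x))%B)).
Proof.
elim: d k f => [|d IHd] k f kd qf f0.
  have notin (q : 'I_n) : (k <= q)%N = false.
    by rewrite leqNgt (leq_trans (ltn_ord q)) // -kd addn0.
  exists (fun=> 0%N), (fun=> fun=> false); split=> // x.
  rewrite big1 => [|q]; last by rewrite notin.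
  by rewrite (_ : tail k x = 0) //; apply/ffunP => q; rewrite !ffunE notin.
have ltkn : (k < n)%N by rewrite -kd -addSnnS leq_addr.
pose q0 := Ordinal ltkn.
have [a0 [m0 am0 fE]] := quad_additive (bvec q0) qf.
(* As [(-1) ^+ (b && c) = 'i ^+ (b + c + 3 * (b (+) c))], splitting off bit [k]
   leaves a factor ['i ^+ m0] for the remaining bits. *)
pose f' z := f z * 'i ^+ m0 z.
have qf' : quad f' by apply: quad_mul => //; exact/quad_i/additive_affine.
have [||a [m [am f'E]]] := IHd k.+1 f' _ qf'; rewrite ?addSnnS //.
  by rewrite /f' f0 (additive0 am0) mulr1.
(* The exponent identity contributes one more power of ['i] in bit [k], hence [a0.+1]. *)
exists (fun q => if q == q0 then a0.+1 else a q),
  (fun q => if q == q0 then m0 else m q); split=> [q|x]; first by case: eqP.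
rewrite (bigD1 q0) //= eqxx.
rewrite [X in _ * X](_ : _ = f' (tail k.+1 x)); last first.
  rewrite f'E; apply: eq_big => [q|q /andP[_ /negbTE->] //].
  by rewrite [RHS]ltn_neqAle andbC eq_sym.
rewrite (tailS q0 x : tail k x = _) /f' /=; set t := tail _ x.
have i4 : 'i ^+ 4 = 1 :> algC by rewrite (exprM _ 2 2) sqrCi sqrrN expr1n.
case xq: (x q0); rewrite ?fE ?addr0 /=.
all: move: (f t) => c; case: (m0 t).
all: rewrite ?muln0 ?muln1 ?expr0 ?expr1 ?mul1r ?mulr1 //.
- by rewrite exprSr mulrACA -expr2 sqrCi [c * _]mulrC.
- by rewrite mulrC exprSr -mulrA -exprS i4 mulr1.
- by rewrite mulrCA -exprSr i4 mulr1.
Qed.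

Lemma quad_split n (f : bitvec n -> algC) : quad f -> f 0 = 1 ->
  exists (a : 'I_n -> nat) (N : bitvec n -> bitvec n),
    [/\ additive_fun N, injective N &
    forall x, f x = \prod_q 'i ^+ (a q * x q) * \prod_q 'i ^+ (3 * N x q)].
Proof.
move=> qf f0; have [a [m [am fE]]] := quad_tail (add0n n) qf f0.
pose N (x : bitvec n) : bitvec n := [ffun q => x q + m q (tail q.+1 x)].
have aN : additive_fun N.
  by move=> x y; apply/ffunP => q; rewrite !ffunE tailD am addrACA.
exists a, N; split=> // [|x].
  apply: additive_inj => // x Nx0.
  (* Back substitution from the highest bit down: once the bits above [k] vanish, bit [k] of [N x]
     is just [x k]. *)
  suff tail0 d k : (k + d)%N = n -> tail k x = 0.
    by rewrite -(tail0 n 0%N (add0n n)); apply/ffunP => q; rewrite ffunE.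
  elim: d k => [|d IHd] k kd.
    by apply/ffunP => q; rewrite !ffunE leqNgt (leq_trans (ltn_ord q)) // -kd addn0.
  have ltkn : (k < n)%N by rewrite -kd -addSnnS leq_addr.
  have /ffunP/(_ (Ordinal ltkn)) := Nx0.
  rewrite !ffunE /= IHd ?addSnnS // (additive0 (am _)) addr0.
  by move=> xk; rewrite (tailS (Ordinal ltkn) x : tail k x = _) /= IHd ?addSnnS // xk add0r.
rewrite -big_split -[x in LHS](_ : tail 0 x = x) ?fE.
  by apply: eq_bigr => q _; rewrite ffunE.
by apply/ffunP => q; rewrite ffunE.
Qed.

(** * CNOT, phase and Hadamard layers *)

Lemma monomial1 n : monomial (1%:M : 'M[algC]_(2 ^ n)) (fun=> 1) id.
Proof. by apply: has_ker_ext (@has_ker1 n) _ => y x; case: eqP. Qed.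

Lemma valid_circuit_cat n (c1 c2 : circuit n) :
  valid_circuit (c1 ++ c2) = valid_circuit c1 && valid_circuit c2.
Proof. exact: all_cat. Qed.

Definition cnot_map n (g : bitvec n -> bitvec n) := exists c : circuit n,
  [/\ valid_circuit c, all (@is_C n) c & monomial (circuit_mx c) (fun=> 1) g].

Lemma cnot_map_ext n (g h : bitvec n -> bitvec n) :
  g =1 h -> cnot_map g -> cnot_map h.
Proof.
move=> eq_gh [c [vc cc mc]]; exists c; split=> //.
by apply: has_ker_ext mc _ => y x; rewrite eq_gh.
Qed.

Lemma cnot_map_id n : cnot_map (@id (bitvec n)).
Proof. by exists [::]; split=> //; exact: monomial1. Qed.

Lemma cnot_map_comp n (g h : bitvec n -> bitvec n) :
  cnot_map g -> cnot_map h -> cnot_map (g \o h).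
Proof.
move=> [c [vc cc mc]] [d [vd cd md]]; exists (d ++ c); split.
- by rewrite valid_circuit_cat vd.
- by rewrite all_cat cd.
rewrite circuit_mx_cat; apply: has_ker_ext (monomial_mul mc md) _ => y x.
by rewrite mulr1.
Qed.

Lemma transvD n p (w : bitvec n) : additive_fun (transv p w).
Proof.
move=> x y; rewrite /transv ffunE; case: (x p) (y p) => [] [].
- by rewrite addrACA bitvecDD addr0.
- by rewrite addrAC.
- by rewrite addrA.
- by [].
Qed.

(** The CNOT gates with control [p] and targets in the support of [w] compose to this map: [p] is no
    target, so the control keeps its value throughout. The condition at [p] is carried along in the
    induction over partial sums. *)
Lemma cnot_map_transv n p (w : bitvec n) : w p = false -> cnot_map (transv p w).
Proof.
rewrite [w in transv p w]bitvec_sum => wp.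
suff [] : (\sum_(q | w q) bvec q) p = false /\
    cnot_map (transv p (\sum_(q | w q) bvec q)) by [].
elim/big_ind: _ => [|u v [up cu] [vp cv]|q wq].
- split; first by rewrite ffunE.
  by apply: cnot_map_ext (@cnot_map_id n) => x; rewrite /transv addr0 if_same.
- split; first by rewrite ffunE up vp.
  apply: cnot_map_ext (cnot_map_comp cu cv) => x; rewrite /transv /=.
  by case xp: (x p); rewrite ?xp // ffunE vp addr0 xp -addrA [v + u]addrC.
have pq : p != q by apply: contraTneq wq => <-; rewrite wp.
split; first by rewrite upd_neq ?ffunE.
exists [:: CNOT p q]; split; rewrite /= ?pq //.
by rewrite /circuit_mx /= mulmx1; exact: monomial_cnot.
Qed.

(** Gaussian elimination over F_2: composing with transvections makes the map fix one more basis
    vector at a time. In [gauss], the first [k] basis vectors are fixed and [d] remain; an additive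
    map fixing all of them is the identity. *)
Lemma cnot_map_additive n (g : bitvec n -> bitvec n) :
  additive_fun g -> injective g -> cnot_map g.
Proof.
have fix_sum (h : bitvec n -> bitvec n) (x : bitvec n) : additive_fun h ->
    (forall q, x q -> h (bvec q) = bvec q) -> h x = x.
  move=> ah hx; rewrite {1}[x]bitvec_sum additive_sum // [RHS]bitvec_sum.
  exact: eq_bigr.
suff gauss d k h : (k + d)%N = n -> additive_fun h -> injective h ->
    (forall q : 'I_n, (q < k)%N -> h (bvec q) = bvec q) -> cnot_map h.
  by move=> ag gI; apply: (gauss n 0%N).
elim: d k h => [|d IHd] k h kd ah hI hk.
  apply: cnot_map_ext (@cnot_map_id n) => x; rewrite fix_sum // => q _.
  by rewrite hk // (leq_trans (ltn_ord q)) // -kd addn0.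
have ltkn : (k < n)%N by rewrite -kd -addSnnS leq_addr.
pose q0 := Ordinal ltkn.
(* With a nonzero pivot, the transvection along [v + bvec q0] sends [v] to [bvec q0]; it fixes the
   earlier basis vectors because their bit [q0] is off. *)
have pivot (h' : bitvec n -> bitvec n) : additive_fun h' -> injective h' ->
    (forall q : 'I_n, (q < k)%N -> h' (bvec q) = bvec q) -> h' (bvec q0) q0 ->
    cnot_map h'.
  move=> ah' h'I h'k piv; set v := h' (bvec q0).
  have w0 : (v + bvec q0) q0 = false by rewrite ffunE upd_eq /v piv.
  apply: cnot_map_ext (cnot_map_comp (cnot_map_transv w0) _) => [x|].
    exact: (transvK w0 (h' x)).
  apply: (IHd k.+1) => [||x y /(can_inj (transvK w0))/h'I//|q].
  - by rewrite addSnnS.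
  - by move=> x y /=; rewrite ah' transvD.
  rewrite ltnS leq_eqVlt => /predU1P[qk|ltqk] /=.
    rewrite (_ : q = q0); last exact: val_inj.
    by rewrite -/v /transv piv addrA bitvecDD add0r.
  rewrite h'k // /transv upd_neq ?ffunE //.
  by rewrite -val_eqE /= gtn_eqF.
case v0: (h (bvec q0) q0); first exact: pivot.
(* Otherwise [h (bvec q0)] lies in the span of the vectors already fixed, so [h] fixes it too, and
   injectivity makes it equal to [bvec q0], whose bit [q0] is set. *)
have [p lekp vp] : exists2 p : 'I_n, (k <= p)%N & h (bvec q0) p.
  apply/exists_inP; apply: contraFT v0; rewrite negb_exists_in => /forall_inP v_k.
  suff /hI-> : h (h (bvec q0)) = h (bvec q0) by rewrite upd_eq.
  apply: fix_sum => // q vq; apply: hk; rewrite ltnNge.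
  by apply: contraL vq => /v_k.
have qp : bvec q0 p = false.
  by rewrite upd_neq ?ffunE //; apply: contraTneq vp => ->; rewrite v0.
(* Adding [bvec q0] whenever bit [p] is set creates the missing pivot and, as [p >= k], leaves the
   earlier basis vectors fixed. *)
apply: cnot_map_ext (cnot_map_comp (cnot_map_transv qp) _) => [x|].
  exact: (transvK qp (h x)).
apply: pivot => [x y|x y /(can_inj (transvK qp))/hI//|q ltqk|] /=.
- by rewrite ah transvD.
- rewrite hk // /transv upd_neq ?ffunE //.
  by rewrite -val_eqE gtn_eqF // (leq_trans ltqk).
- by rewrite /transv vp ffunE v0 upd_eq.
Qed.

(** * Phase layers *)

Definition phase_map n (phi : bitvec n -> algC) := exists c : circuit n,
  [/\ valid_circuit c, all (@is_P n) c & monomial (circuit_mx c) phi id].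

Lemma phase_map_ext n (phi psi : bitvec n -> algC) :
  phi =1 psi -> phase_map phi -> phase_map psi.
Proof.
move=> eq_phi [c [vc pc mc]]; exists c; split=> //.
by apply: has_ker_ext mc _ => y x; rewrite eq_phi.
Qed.

Lemma phase_map1 n : phase_map (fun _ : bitvec n => 1).
Proof. by exists [::]; split=> //; exact: monomial1. Qed.

Lemma phase_map_mul n (phi psi : bitvec n -> algC) :
  phase_map phi -> phase_map psi -> phase_map (fun x => phi x * psi x).
Proof.
move=> [c [vc pc mc]] [d [vd pd md]]; exists (d ++ c); split.
- by rewrite valid_circuit_cat vd.
- by rewrite all_cat pd.
- by rewrite circuit_mx_cat; exact: monomial_mul mc md.
Qed.

Lemma phase_map_exp n (q : 'I_n) k : phase_map (fun x => 'i ^+ (k * x q)).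
Proof.
elim: k => [|k IHk].
  by apply: phase_map_ext (@phase_map1 n) => x; rewrite mul0n.
have pq : phase_map (fun x : bitvec n => 'i ^+ x q).
  exists [:: Phs q]; split=> //; rewrite /circuit_mx /= mulmx1.
  exact: monomial_phs.
by apply: phase_map_ext (phase_map_mul pq IHk) => x; rewrite mulSn exprD.
Qed.

Lemma phase_map_prod n (a : 'I_n -> nat) :
  phase_map (fun x => \prod_q 'i ^+ (a q * x q)).
Proof.
elim: (index_enum _) => [|q r IHr].
  by apply: phase_map_ext (@phase_map1 n) => x; rewrite big_nil.
apply: phase_map_ext (phase_map_mul (phase_map_exp q (a q)) IHr) => x.
by rewrite big_cons.
Qed.

(** * Hadamard layers *)

Definition had_layer n : circuit n := [seq Had q | q <- enum 'I_n].

(** A partial layer is needed for the induction: qubits outside [s] contribute a Kronecker delta. *)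
Lemma has_ker_had_seq n (s : seq 'I_n) : uniq s ->
  has_ker (circuit_mx [seq Had q | q <- s])
    (fun y x => (sqrtC 2%:R)^-1 ^+ size s *
       \prod_q (if q \in s then (-1) ^+ (y q && x q) else (y q == x q)%:R)).
Proof.
elim: s => [_|q s IHs /= /andP[qs us]].
  apply: has_ker_ext (@has_ker1 n) _ => y x; rewrite mul1r.
  case: eqP => [->|/eqP ne_yx]; first by rewrite big1 // => q _; rewrite eqxx.
  have [q ne_q] : exists q, y q != x q.
    apply/existsP; apply: contraNT ne_yx; rewrite negb_exists => /forallP eq_q.
    by apply/eqP/ffunP => q; apply/eqP; rewrite -[_ == _]negbK eq_q.
  by rewrite (bigD1 q) //= (negbTE ne_q) mul0r.
rewrite circuit_mx_cons; apply: has_ker_ext (has_ker_mul_had q (IHs us)) _ => y x.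
(* The new Hadamard gate sums over the value [b] of column bit [q]; the delta at [q] keeps only
   [b = y q]. *)
have split_q b : \prod_p (if p \in s then (-1) ^+ (y p && upd x q b p)
      else (y p == upd x q b p)%:R)
    = (y q == b)%:R * \prod_(p | p != q)
       (if p \in q :: s then (-1) ^+ (y p && x p) else (y p == x p)%:R) :> algC.
  rewrite (bigD1 q) //= (negbTE qs) upd_eq; congr (_ * _).
  by apply: eq_bigr => p pq; rewrite upd_neq // inE (negbTE pq).
rewrite !split_q [in RHS](bigD1 q) //= mem_head exprS.
set P := \prod_(_ | _) _; set s2 := _ ^-1.
rewrite [LHS]mulrC -[RHS]mulrA; congr (_ * _).
case: (y q) => /=; rewrite !(mul0r, mul1r, mulr0, add0r, addr0) ?expr0 ?mul1r //.
by rewrite mulrCA.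
Qed.

Lemma has_ker_had_layer n :
  has_ker (circuit_mx (had_layer n))
    (fun y x => (sqrtC 2%:R)^-1 ^+ n * \prod_q (-1) ^+ (y q && x q)).
Proof.
apply: has_ker_ext (has_ker_had_seq (enum_uniq 'I_n)) _ => y x.
by rewrite size_enum_ord; congr (_ * _); apply: eq_bigr => q _; rewrite mem_enum.
Qed.

Lemma had_seqK n (s : seq 'I_n) :
  circuit_mx [seq Had q | q <- rev s ++ s] = 1%:M.
Proof.
elim: s => [//|q s IHs].
rewrite rev_cons -cats1 -catA map_cat circuit_mx_cat /= !circuit_mx_cons /=.
rewrite -[circuit_mx _ *m _ *m had_mx q]mulmxA had_mxK mulmx1.
by rewrite -circuit_mx_cat -map_cat.
Qed.

(** * Quadratic kernels and the normal form *)

Section Polar.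
Variables (T : zmodType) (f : T -> algC).
Hypothesis qf : quad f.

(* [polar z u] is the exponent of [-1] in [f (z + u) f 0 / (f z f u)]. *)
Definition polar z u := f (z + u) * f 0 != f z * f u.

Lemma polarC z u : polar z u = polar u z.
Proof. by rewrite /polar addrC [f z * _]mulrC. Qed.

(** Evaluating the quadratic condition at [z = 0] gives [f u = f 0 * 'i ^+ a], which eliminates the
    constant and leaves only the sign. *)
Lemma polar_additive u : exists2 m : T -> bool, additive_fun m &
  forall z, polar z u = m z /\ f (z + u) * f 0 = f z * f u * (-1) ^+ m z.
Proof.
have [f0 _] := qf; have [a [m am fE]] := quad_additive u qf.
exists m => // z.
have fu : f u = f 0 * 'i ^+ a by rewrite -[u in LHS]add0r fE (additive0 am) mulr1.
have polarE : f (z + u) * f 0 = f z * f u * (-1) ^+ m z.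
  by rewrite fE fu mulrAC [f z * _ * f 0]mulrAC -[f z * f 0 * _]mulrA.
split=> //; rewrite /polar polarE; case: (m z); last by rewrite mulr1 eqxx.
by rewrite mulrN1 eqNr mulf_neq0.
Qed.

Lemma polarE z u : f (z + u) * f 0 = f z * f u * (-1) ^+ polar z u.
Proof. by have [m _ /(_ z)[-> ->]] := polar_additive u. Qed.

Lemma polarDl z z' u : polar (z + z') u = polar z u (+) polar z' u.
Proof.
have [m am mE] := polar_additive u.
by rewrite (proj1 (mE _)) (proj1 (mE z)) (proj1 (mE z')) am.
Qed.

Lemma polarDr z u u' : polar z (u + u') = polar z u (+) polar z u'.
Proof. by rewrite ![polar z _]polarC polarDl. Qed.

End Polar.

(** By [quad_split], [f] is a phase layer in the bits of [x] times a cubed phase layer in the bits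
    of [N x]. Between them CNOT gates compute [N]; the last CNOT round replaces [N x] by [h x]. *)
Lemma quad_PCPC n (f : bitvec n -> algC) (h : bitvec n -> bitvec n) :
  quad f -> f 0 = 1 -> additive_fun h -> injective h ->
  exists r1 r2 r3 r4 : circuit n,
    [/\ [&& all (@is_P n) r1, all (@is_C n) r2, all (@is_P n) r3 & all (@is_C n) r4],
        valid_circuit (r1 ++ r2 ++ r3 ++ r4) &
        monomial (circuit_mx (r1 ++ r2 ++ r3 ++ r4)) f h].
Proof.
move=> qf f0 ah hI; have [a [N [aN NI fE]]] := quad_split qf f0.
have [r1 [v1 t1 m1]] := phase_map_prod a.
have [r2 [v2 t2 m2]] := cnot_map_additive aN NI.
have [r3 [v3 t3 m3]] := @phase_map_prod n (fun=> 3%N).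
have [||r4 [v4 t4 m4]] := @cnot_map_additive n (h \o invF NI).
- move=> x y /=; rewrite -ah; congr (h _).
  by apply: (NI _ _); rewrite aN !f_invF.
- by move=> x y /hI /(can_inj (f_invF NI)).
exists r1, r2, r3, r4; split; first by rewrite t1 t2 t3.
  by rewrite !valid_circuit_cat v1 v2 v3.
rewrite !circuit_mx_cat.
apply: has_ker_ext (monomial_mul (monomial_mul (monomial_mul m4 m3) m2) m1) _.
by move=> y x /=; rewrite invF_f fE mul1r mulr1 mulrC.
Qed.

Lemma fst_additive (T1 T2 : zmodType) : additive_fun (fst : T1 * T2 -> T1).
Proof. by move=> [? ?] [? ?]. Qed.

Lemma snd_additive (T1 T2 : zmodType) : additive_fun (snd : T1 * T2 -> T2).
Proof. by move=> [? ?] [? ?]. Qed.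

Lemma pair_affine (T T1 T2 : zmodType) (g : T -> T1) (h : T -> T2) :
  affine_fun g -> affine_fun h -> affine_fun (fun z => (g z, h z)).
Proof. by move=> ag ah u v w; rewrite ag ah. Qed.

Lemma coord_affine (T : zmodType) n (g : T -> bitvec n) q :
  affine_fun g -> affine_fun (fun z => g z q).
Proof. by move=> ag u v w; rewrite ag !ffunE. Qed.

Lemma upd_affine (T : zmodType) n (g : T -> bitvec n) q (b : T -> bool) :
  affine_fun g -> affine_fun b -> affine_fun (fun z => upd (g z) q (b z)).
Proof. by move=> ag ab u v w; rewrite ag ab !updD. Qed.

Lemma quad_kernel_circuit n (f : bitvec n * bitvec n -> algC) U :
  quad f -> U \in unitmx -> has_ker U (fun y x => f (y, x)) ->
  exists r3 r4 r5 r6 r7 r8 r9 r10 r11 : circuit n, exists z : algC,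
    [/\ [&& all (@is_P n) r3, all (@is_C n) r4, all (@is_P n) r5, all (@is_C n) r6
          & all (@is_H n) r7],
        [&& all (@is_P n) r8, all (@is_C n) r9, all (@is_P n) r10 & all (@is_C n) r11],
        valid_circuit (r3 ++ r4 ++ r5 ++ r6 ++ r7 ++ r8 ++ r9 ++ r10 ++ r11) &
        circuit_mx (r3 ++ r4 ++ r5 ++ r6 ++ r7 ++ r8 ++ r9 ++ r10 ++ r11) = z *: U].
Proof.
move=> qf uU kU; have [f_neq0 _] := qf.
pose emb1 (y : bitvec n) : bitvec n * bitvec n := (y, 0).
pose emb2 (x : bitvec n) : bitvec n * bitvec n := (0, x).
have emb1D : additive_fun emb1 by move=> y y'; rewrite /emb1 -[0 in LHS]addr0.
have emb2D : additive_fun emb2 by move=> x x'; rewrite /emb2 -[0 in LHS]addr0.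
have embD y x : emb1 y + emb2 x = (y, x).
  by congr (_, _); rewrite /= ?addr0 ?add0r.
pose f0 := f 0.
have f0_neq0 : f0 != 0 by exact: f_neq0.
have quad_emb (emb : bitvec n -> bitvec n * bitvec n) :
    additive_fun emb -> quad (fun x => f (emb x) / f0).
  move=> aemb; apply: quad_mul; last by apply: quad_cst; rewrite invr_eq0.
  exact: quad_comp (additive_affine aemb) qf.
have emb_1 (emb : bitvec n -> bitvec n * bitvec n) :
    additive_fun emb -> f (emb 0) / f0 = 1.
  by move=> aemb; rewrite (additive0 aemb) divff.
(* The polar form pairs a row [y] with a column [x] bilinearly; [g] is its matrix, so the pairing is
   the dot product of [y] and [g x]. *)
pose g x : bitvec n := [ffun q => polar f (emb1 (bvec q)) (emb2 x)].
have ag : additive_fun g.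
  by move=> x x'; apply/ffunP => q; rewrite !ffunE emb2D polarDr.
have polar_g y x :
    (-1) ^+ polar f (emb1 y) (emb2 x) = \prod_q (-1) ^+ (y q && g x q) :> algC.
  pose b y' := polar f (emb1 y') (emb2 x).
  have ab : additive_fun b by move=> y1 y2; rewrite /b emb1D polarDl.
  rewrite -/(b y) {1}[y]bitvec_sum (additive_sum _ _ _ ab).
  rewrite (big_morph (fun c : bool => (-1) ^+ c) (@signr_addb _) (erefl _)).
  rewrite big_mkcond; apply: eq_bigr => q _; rewrite ffunE.
  by case: (y q).
(* If [g x = 0], the cross term disappears and column [x] is proportional to column [0]. *)
have gI : injective g.
  apply: additive_inj => // x gx0.
  apply: (has_ker_col_indep (z := f (emb2 x) / f0) uU kU) => y.
  apply: (mulIf f0_neq0); rewrite -embD polarE // polar_g big1 => [|q _].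
    by rewrite mulr1 mulrAC divfK // mulrC.
  by rewrite gx0 ffunE andbF.
have [r3 [r4 [r5 [r6 [t3 v3 m3]]]]] :=
  quad_PCPC (quad_emb _ emb2D) (emb_1 _ emb2D) ag gI.
have [r8 [r9 [r10 [r11 [t8 v8 m8]]]]] :=
  @quad_PCPC n _ id (quad_emb _ emb1D) (emb_1 _ emb1D) (fun _ _ => erefl) (fun _ _ => id).
exists r3, r4, r5, r6, (had_layer n), r8, r9, r10, r11.
(* The power normalises the Hadamard layer. Both outer factors are divided by [f0], but polarisation
   restores only one [f0]. *)
exists ((sqrtC 2%:R)^-1 ^+ n / f0); split=> //.
- case/and4P: t3 => -> -> -> -> /=.
  by rewrite all_map; apply/allP.
- move: v3 v8; rewrite !valid_circuit_cat => /and4P[-> -> -> ->] /and4P[-> -> -> ->].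
  by rewrite !andbT /valid_circuit all_map; apply/allP.
rewrite !catA -4!catA circuit_mx_cat -!catA circuit_mx_cat -mulmxA.
have kA := has_ker_monomial_mul (g := id) (g' := id) (fun _ => erefl) (fun _ => erefl)
  m8 (has_ker_mul_monomial (@has_ker_had_layer n) m3).
apply: has_ker_eq kA _ => r c; rewrite mxE kU -embD.
move: (bits r) (bits c) => y x.
apply: (mulIf f0_neq0); rewrite -[LHS]mulrA polarE // polar_g -/f0.
by field.
Qed.

(** * Adding one gate to a quadratic kernel *)

Lemma quad_prod (T : zmodType) (I : Type) (r : seq I) (F : I -> T -> algC) :
  (forall i, quad (F i)) -> quad (fun z => \prod_(i <- r) F i z).
Proof.
move=> qF; elim: r => [|i r IHr].
  by apply: quad_ext (quad_cst T (oner_neq0 _)) => z; rewrite big_nil.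
by apply: quad_ext (quad_mul (qF i) IHr) => z; rewrite big_cons.
Qed.


(** For [w] equal to ['i] or its opposite, the ratio of [1 - w] to [1 + w] is [- w = w ^+ 3], again
    a power of ['i]. *)
Lemma one_add_signr_sqr_m1 (w : algC) (b : bool) : w ^+ 2 = -1 ->
  1 + w * (-1) ^+ b = (1 + w) * (w ^+ 3) ^+ b.
Proof.
move=> w2; have w3 : w ^+ 3 = - w by rewrite exprS w2 mulrN1.
case: b => /=; last by rewrite !mulr1.
by rewrite !expr1 w3 mulrN1 mulrN mulrDl mul1r -expr2 w2 opprD opprK addrC.
Qed.

(** The two summands over bit [j] have ratio [w * (-1) ^+ l] with [w = 'i ^+ a]. For odd [a] they
    never cancel and [s] is empty; for even [a] they cancel off a hyperplane, and [s] is a single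
    qubit. *)
Lemma quad_had n (f : bitvec n * bitvec n -> algC) j U : quad f -> U \in unitmx ->
  has_ker U (fun y x => f (y, x)) ->
  exists (s : seq 'I_n) (f' : bitvec n * bitvec n -> algC),
    quad f' /\
    has_ker (had_mx j *m U *m circuit_mx [seq Had q | q <- s])
      (fun y x => f' (y, x)).
Proof.
move=> qf uU kU; have [a [m am fE]] := quad_additive (bvec j, 0) qf.
pose T := (bitvec n * bitvec n)%type.
have fstA : affine_fun (fst : T -> _) by exact/additive_affine/fst_additive.
have sndA : affine_fun (snd : T -> _) by exact/additive_affine/snd_additive.
pose P (z : T) : T := (upd z.1 j false, z.2).
have aP : affine_fun P.
  by apply: pair_affine => //; apply: upd_affine => //; exact: affine_cst.
have amP : affine_fun (m \o P) by apply: affine_comp => //; exact: additive_affine.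
(* The first summand is the sign of the Hadamard gate; the second comes from shifting [P z], where
   bit [j] is cleared, by [bvec j]. *)
pose l (z : T) : bool := z.1 j + m (P z).
have al : affine_fun l by apply: affine_add => //; exact: coord_affine.
pose s2 : algC := (sqrtC 2%:R)^-1; pose w : algC := 'i ^+ a.
have s2_neq0 : s2 != 0 by rewrite invr_eq0 sqrtC_eq0 pnatr_eq0.
have kHU : has_ker (had_mx j *m U)
    (fun y x => f (P (y, x)) * s2 * (1 + w * (-1) ^+ l (y, x))).
  apply: has_ker_ext (has_ker_had_mul j kU) _ => y x.
  have -> : (upd y j true, x) = P (y, x) + (bvec j, 0).
    by rewrite /P /=; congr (_, _); rewrite /= ?addr0 // updE.
  rewrite fE -/w /l signr_addb -/s2 /P /=; ring.
have [a_odd|a_even] := boolP (odd a).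
  have w2 : w ^+ 2 = -1.
    by rewrite -exprM mulnC exprM sqrCi -signr_odd a_odd expr1.
  have w1_neq0 : 1 + w != 0.
    apply: contraTneq isT => /eqP; rewrite addrC addr_eq0 => /eqP wE.
    by move/eqP: w2; rewrite wE sqrrN expr1n -addr_eq0 -mulr2n pnatr_eq0.
  exists [::], (fun z => f (P z) * s2 * ((1 + w) * ('i ^+ l z) ^+ (a * 3))); split.
    apply: quad_mul; first by apply: quad_mul; [exact: quad_comp | exact: quad_cst].
    by apply: quad_mul; [exact: quad_cst | apply/quad_exp/quad_i].
  rewrite mulmx1; apply: has_ker_ext kHU _ => y x; congr (_ * _).
  by rewrite one_add_signr_sqr_m1 // /w -!exprM [in RHS]mulnC mulnA.
(* If [m] ignored every column bit, row [bvec j] would be [w] times row [0], against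
   invertibility. *)
have [k mk] : exists k, m (0, bvec k).
  apply/existsP; apply: contraT; rewrite negb_exists => /forallP m_row.
  have m0 x : m (0, x) = false.
    have am2 : additive_fun (fun x' : bitvec n => m (0, x')).
      by move=> x1 x2; rewrite -am; congr (m (_, _)); rewrite addr0.
    rewrite [x]bitvec_sum (additive_sum _ _ _ am2) big1 // => q _.
    exact/negbTE/m_row.
  suff /ffunP/(_ j) : bvec j = 0 by rewrite upd_eq ffunE.
  apply: (has_ker_row_indep (z := w) uU kU) => x.
  have -> : (bvec j, x) = (0, x) + (bvec j, 0) by congr (_, _); rewrite /= ?add0r ?addr0.
  by rewrite fE m0 mulr1 mulrC.
pose e := odd a./2.
have wE : w = (-1) ^+ e.
  by rewrite /w -[a]odd_double_half (negbTE a_even) -mul2n exprM sqrCi /e signr_odd.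
(* The one value of column bit [k] that puts the point on the supporting hyperplane [l = e]. *)
pose t (z : T) : bool := e + l (z.1, upd z.2 k false).
have at_ : affine_fun t.
  apply: affine_add; first exact/affine_cst/addbb.
  apply: (affine_comp (g := fun z : T => (z.1, upd z.2 k false))) => //.
  by apply: pair_affine => //; apply: upd_affine => //; exact: affine_cst.
pose Q (z : T) : T := P (z.1, upd z.2 k (t z)).
have aQ : affine_fun Q.
  apply: (affine_comp (g := fun z : T => (z.1, upd z.2 k (t z)))) => //.
  by apply: pair_affine => //; exact: upd_affine.
(* The sum over column bit [k] retains only the value [t z]: [2] is the surviving [1 + 1], each [s2]
   normalises one Hadamard gate, and the sign is the entry of the new gate. *)
exists [:: k], (fun z => f (Q z) * (s2 * 2%:R * s2 * (-1) ^+ (z.2 k && t z))); split.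
  apply: quad_mul; first exact: quad_comp.
  apply: quad_mul; last by apply: quad_sign_and => //; exact: coord_affine.
  by apply: quad_cst; rewrite !mulf_neq0 // pnatr_eq0.
rewrite /= /circuit_mx /= mulmx1.
apply: has_ker_ext (has_ker_mul_had k kHU) _ => y x.
have lt b : l (y, upd x k b) = e + t (y, x) + b.
  have Pk : P (y, upd x k b) = P (y, upd x k false) + (0, if b then bvec k else 0).
    by rewrite /P /= (updE x); congr (_, _); rewrite /= ?addr0.
  have mb : m (0, if b then bvec k else 0) = b.
    by case: b {Pk}; [exact: mk | exact: additive0 am].
  by rewrite /t /l /= Pk am mb !bool_addE !addbA addbb.
rewrite !lt wE /Q /= -/s2 -!signr_addb !bool_addE.
by case: (e) (t (y, x)) => [] []; rewrite /= ?expr0 ?expr1 ?andbT ?andbF; ring.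
Qed.

Lemma quad_normal n (c : circuit n) : valid_circuit c ->
  exists (s : seq 'I_n) (f : bitvec n * bitvec n -> algC),
    quad f /\ has_ker (circuit_mx ([seq Had q | q <- s] ++ c)) (fun y x => f (y, x)).
Proof.
have fstA : affine_fun (fst : bitvec n * bitvec n -> _).
  exact/additive_affine/fst_additive.
have sndA : affine_fun (snd : bitvec n * bitvec n -> _).
  exact/additive_affine/snd_additive.
elim/last_ind: c => [_|c g IHc].
  (* The identity has zero entries, so even the empty circuit needs Hadamard gates: a full layer has
     a kernel that vanishes nowhere. *)
  exists (enum 'I_n), (fun z : bitvec n * bitvec n =>
    (sqrtC 2%:R)^-1 ^+ n * \prod_q (-1) ^+ (z.1 q && z.2 q)).
  split; last by rewrite cats0; exact: has_ker_had_layer.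
  apply: quad_mul.
    by apply: quad_cst; rewrite expf_neq0 // invr_eq0 sqrtC_eq0 pnatr_eq0.
  by apply: quad_prod => q; apply: quad_sign_and; exact: coord_affine.
rewrite /valid_circuit all_rcons => /andP[vg vc].
have [s [f [qf kf]]] := IHc vc.
have uU : circuit_mx ([seq Had q | q <- s] ++ c) \in unitmx.
  by apply: circuit_unitmx; rewrite /valid_circuit all_cat vc andbT all_map; apply/allP.
case: g vg => [q|q|a b] vg.
- have [s' [f' [qf' kf']]] := quad_had q qf uU kf.
  (* The extra gates multiply on the right, that is, they act before all others. *)
  exists (s' ++ s), f'; split=> //.
  by rewrite map_cat -catA -rcons_cat circuit_mx_cat circuit_mx_rcons.
- exists s, (fun z : bitvec n * bitvec n => 'i ^+ z.1 q * f z); split.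
    by apply: quad_mul => //; exact/quad_i/coord_affine.
  rewrite -rcons_cat circuit_mx_rcons.
  exact: (has_ker_monomial_mul (g := id) (g' := id)) (monomial_phs q) kf.
- exists s, (fun z : bitvec n * bitvec n => f (transv a (bvec b) z.1, z.2)); split.
    apply: (quad_comp (g := fun z => (transv a (bvec b) z.1, z.2))) qf.
    apply: pair_affine => //; apply: (affine_comp (h := transv a (bvec b))) => //.
    exact/additive_affine/transvD.
  have ba : bvec b a = false by rewrite upd_neq ?ffunE.
  rewrite -rcons_cat circuit_mx_rcons.
  have kC := has_ker_monomial_mul (transvK ba) (transvK ba) (monomial_cnot a b) kf.
  by apply: has_ker_ext kC _ => y x; rewrite mul1r.
Qed.

Theorem theorem8 (n : nat) (c : circuit n) :
  valid_circuit c ->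
  exists c' : circuit n, [/\ valid_circuit c', canonical_form c' & equiv_circuits c' c].
Proof.
move=> vc; have [s [f [qf kf]]] := quad_normal vc.
have v_had (r : seq 'I_n) : valid_circuit [seq Had q | q <- r].
  by rewrite /valid_circuit all_map; apply/allP.
have t_had (r : seq 'I_n) : all (@is_H n) [seq Had q | q <- r].
  by rewrite all_map; apply/allP.
have vsc : valid_circuit ([seq Had q | q <- s] ++ c) by rewrite valid_circuit_cat v_had.
have [r3 [r4 [r5 [r6 [r7 [r8 [r9 [r10 [r11 [z [t3 t8 vr eqr]]]]]]]]]]] :=
  quad_kernel_circuit qf (circuit_unitmx vsc) kf.
(* Reversal makes these gates cancel the prepended ones pair by pair, from the inside out. *)
pose r1 : circuit n := [seq Had q | q <- rev s].
have v' : valid_circuit (r1 ++ r3 ++ r4 ++ r5 ++ r6 ++ r7 ++ r8 ++ r9 ++ r10 ++ r11).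
  by rewrite valid_circuit_cat v_had.
eexists; split; first exact: v'.
  (* The first CNOT round stays empty, since the factorisation of a quadratic kernel begins with a
     phase round. *)
  exists r1, [::], r3, r4, r5, r6, r7, r8, r9, r10, r11; split=> //.
    by case/and5P: t3 => -> -> -> -> _; rewrite t_had.
  by case/and5P: t3 => _ _ _ _ ->.
apply: (equiv_circuits_scale (z := z)) => //.
rewrite circuit_mx_cat eqr -scalemxAl -circuit_mx_cat catA -map_cat.
by rewrite circuit_mx_cat had_seqK mulmx1.
Qed.
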